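(* Let $n\ge 4$ be an even integer, and let $G$ be a finite solvable group such that its character degree graph $\Delta(G)$ is an $(n-2)$-regular graph on $n$ vertices. Let $n_1$ be an integer with $1\le n_1<\frac{n}{2}$, and construct a supergraph $\widetilde{\Delta}$ of $\Delta(G)$ (on the same vertex set) by selecting $n_1$ disjoint non-edges of $\Delta(G)$ and adding them as edges. Then the field extension of $\mathbb{Q}$ generated by the eigenvalues of (the adjacency matrix of) $\widetilde{\Delta}$ has degree $2$ over $\mathbb{Q}$.
   Context: For a finite group $G$, let $\mathrm{Irr}(G)$ be the set of irreducible complex characters of $G$, $\mathrm{cd}(G)=\{\chi(1)\mid\chi\in\mathrm{Irr}(G)\}$, and let $\rho(G)$ be the set of all primes dividing some element of $\mathrm{cd}(G)$. The character degree graph $\Delta(G)$ is the simple undirected graph with vertex set $\rho(G)$ in which two distinct primes $p,q$ are adjacent if and only if $pq$ divides $\chi(1)$ for some $\chi\in\mathrm{Irr}(G)$. A non-edge is a pair of distinct nonadjacent vertices; non-edges are disjoint if they share no vertex. *)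

(* Defs.v *)
From HB Require Import structures.
From mathcomp Require Import all_boot all_order all_fingroup all_algebra.
From mathcomp Require Import all_solvable all_field all_character.

Set Implicit Arguments.
Unset Strict Implicit.
Unset Printing Implicit Defensive.

Import GroupScope GRing.Theory Num.Theory.
Local Open Scope ring_scope.

Section DegreeGraph.

Variables (gT : finGroupType) (G : {group gT}).

(* 'chi_i 1%g is a natural number in algC, so Num.truncn only changes its
   type (see truncn_irr1 below). *)
Definition cd : seq nat :=
  undup [seq Num.truncn ('chi[G]_i 1%g) | i : Iirr G].

Definition rho : seq nat := undup (flatten [seq primes d | d <- cd]).

Definition degree_vertex : finType := seq_sub rho.

Definition degree_graph : rel degree_vertex :=
  fun p q => (p != q) && has (fun d => (ssval p * ssval q %| d)%N) cd.

Lemma truncn_irr1 (i : Iirr G) :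
  (Num.truncn ('chi_i 1%g))%:R = 'chi_i 1%g :> algC.
Proof. by rewrite irr1_degree natrK. Qed.

Lemma mem_cd d :
  reflect (exists i : Iirr G, 'chi_i 1%g = d%:R :> algC) (d \in cd).
Proof.
rewrite mem_undup; apply: (iffP mapP) => [[i _ ->]|[i def_d]]; exists i.
- by rewrite truncn_irr1.
- exact: mem_enum.
by rewrite def_d natrK.
Qed.

Lemma mem_rho p :
  reflect (prime p /\ exists2 d, d \in cd & (p %| d)%N) (p \in rho).
Proof.
rewrite mem_undup.
apply: (iffP flatten_mapP) => [[d cd_d]|[pr_p [d cd_d p_d]]].
  by rewrite mem_primes => /and3P[? _ ?]; split=> //; exists d.
exists d => //; rewrite mem_primes pr_p p_d andbT /=.
have /mem_cd[i def_d] := cd_d.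
by rewrite -(ltr0n algC) -def_d irr1_gt0.
Qed.

End DegreeGraph.

Section Graphs.

Variable V : finType.
Implicit Types (e : rel V) (M : {set {set V}}).

Definition regular e k := forall v, #|[set w | e v w]| = k.

Definition non_edge e (s : {set V}) : bool :=
  [exists u, exists v, [&& u != v, ~~ e u v & s == [set u; v]]].

Definition add_edges e M : rel V := fun u v => e u v || ([set u; v] \in M).

Definition adjacency_mx e : 'M[algC]_#|V| :=
  \matrix_(i, j) (e (enum_val i) (enum_val j))%:R.

End Graphs.

(* [Q(S) : Q] = d. The embedding iota identifies L with the subfield Q(S) of
   algC; <<1 & s>> is the subalgebra, hence subfield, generated by s. *)
Definition Q_adjoin_degree (S : {pred algC}) (d : nat) : Prop :=
  exists (L : fieldExtType rat) (iota : {rmorphism L -> algC}) (s : seq L),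
    [/\ map iota s =i S, <<1 & s>>%VS = fullv & \dim {:L} = d].

(* Main.v *)
(** In an (n-2)-regular graph on n vertices every vertex has a unique
    non-neighbour, so adding n1 disjoint non-edges leaves a graph in which v is
    adjacent to everything except v and sigma v, for an involution sigma with
    2 n1 fixed points. If f is an eigenvector for an eigenvalue x other than 0,
    -1, -2, then f is constant on the fixed points of sigma and on their
    complement, and summing its values gives
    x^2 = (n - 3) x + (n + 2 n1 - 2). Both roots of this equation do occur, and
    its discriminant (n - 1)^2 + 8 n1 is not a square. *)

Require Import Defs.
From mathcomp Require Import all_boot all_order all_fingroup all_algebra.
From mathcomp Require Import all_solvable all_field all_character.
From mathcomp Require Import ring zify.

(** * Quadratic number fields, and eigenvectors as functions on the vertices *)

Section EigenvalueField.

Import Order.TTheory GRing.Theory Num.Theory.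
Local Open Scope ring_scope.

(** As a root of the monic integer polynomial X^2 - d, [z] is an algebraic integer, and a rational
    algebraic integer is an integer. *)
Lemma Crat_sqr_nat (z : algC) (d : nat) :
  z \in Crat -> z ^+ 2 = d%:R -> exists k : nat, d = (k ^ 2)%N.
Proof.
move=> Qz z2.
have Az : z \in Aint.
  apply: (@root_monic_Aint ('X^2 - (d%:R)%:P)).
  - by rewrite rootE !hornerE z2 subrr.
  - by rewrite monicXnsubC.
  apply/polyOverP=> i; rewrite coefB coefXn coefC.
  by case: ifP => _; rewrite rpredB ?rpred_nat ?rpred0.
have /intrP[m zm] := Cint_rat_Aint Qz Az.
exists `|m|%N; apply/eqP; rewrite -(eqr_nat algC) -z2 zm natrX.
by rewrite natr_absz intr_norm real_normK ?realz.
Qed.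

Lemma Q_adjoin_degree_quadratic (r : seq algC) (b c : rat) (x0 : algC) :
    x0 \in r -> x0 \notin Crat -> x0 ^+ 2 = ratr b * x0 + ratr c ->
    {in r, forall y, y \in Crat \/ y ^+ 2 = ratr b * y + ratr c} ->
  Q_adjoin_degree (mem r) 2.
Proof.
move=> rx0 Qx0 x0E rE.
have [L [iota [s sr genL]]] := num_field_exists r.
exists L, iota, s; split=> //; first by move=> y; rewrite sr.
have iotaA (a : rat) : iota a%:A = ratr a.
  exact: (fmorph_eq_rat (iota \o in_alg L)).
have /mapP[x sx x0x] : x0 \in map iota s by rewrite sr.
have xE : x ^+ 2 = b%:A * x + c%:A.
  by apply: (fmorph_inj iota); rewrite rmorphXn rmorphD rmorphM /= !iotaA -x0x.
have fullE : fullv = <<1; x>>%VS :> {vspace L}.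
  apply/eqP; rewrite eqEsubv subvf andbT -genL.
  apply/Fadjoin_seqP; split; first exact: subv_adjoin.
  move=> y sy; have : iota y \in r by rewrite -sr map_f.
  case/rE=> [/CratP[a ya] | yE].
    have -> : y = a%:A by apply: (fmorph_inj iota); rewrite iotaA.
    by rewrite memvZ ?mem1v.
  have yE' : y ^+ 2 = b%:A * y + c%:A.
    by apply: (fmorph_inj iota); rewrite rmorphXn rmorphD rmorphM /= !iotaA.
  (* Subtracting the quadratic equations of [y] and [x] gives this factorization: [y] is [x] or its
     conjugate [b - x], so it lies in Q(x). *)
  have : (y - x) * (y + x - b%:A) == 0.
    by apply/eqP; transitivity (y ^+ 2 - b%:A * y - (x ^+ 2 - b%:A * x));
      [ring | rewrite yE' xE; ring].
  rewrite mulf_eq0 => /orP[|]; rewrite subr_eq0 => /eqP yx.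
    by rewrite yx memv_adjoin.
  have -> : y = b%:A - x by rewrite -yx addrK.
  by rewrite memvB ?memvZ ?memv_adjoin ?mem1v.
have x1 : x \notin 1%AS.
  apply: contra Qx0 => /vlineP[a xa].
  by rewrite x0x xa iotaA Crat_rat.
(* The minimal polynomial of [x] divides [q], so the degree is at most 2; it is not 1 because [x] is
   irrational. *)
pose q : {poly L} := 'X^2 - b%:A *: 'X - c%:A%:P.
have sz_q : size q = 3%N.
  rewrite /q -addrA size_polyDl size_polyXn // -opprD size_polyN.
  rewrite (leq_ltn_trans (size_polyD _ _)) // gtn_max.
  rewrite (leq_ltn_trans (size_scale_leq _ _)) ?size_polyX //.
  by rewrite (leq_ltn_trans (size_polyC_leq1 _)).
have q1 : q \is a polyOver 1%AS.
  by rewrite !rpredB ?polyOverZ ?polyOverC ?rpredX ?polyOverX ?memvZ ?mem1v.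
have qx : root q x by rewrite rootE !hornerE xE; apply/eqP; ring.
have := dvdp_leq _ (minPoly_dvdp q1 qx).
rewrite -size_poly_gt0 sz_q size_minPoly => /(_ isT) deg_le.
rewrite fullE (dim_Fadjoin 1%AS) dimv1 muln1; apply/eqP.
by rewrite eqn_leq -ltnS deg_le ltn_neqAle eq_sym adjoin_deg_eq1 x1.
Qed.

(** Frees eigenvectors from the enumeration of [V]. Eigenvectors are row vectors, hence the sum over
    the first argument of [e]. *)
Lemma eigenvalue_adjacencyP (V : finType) (e : rel V) (x : algC) :
  reflect (exists2 f : V -> algC, exists v, f v != 0 &
             forall v, \sum_u f u * (e u v)%:R = x * f v)
          (eigenvalue (adjacency_mx e) x).
Proof.
apply: (iffP eigenvalueP) => [[w wE nzw] | [f [v0 nzf] fE]].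
  exists (fun v => w 0 (enum_rank v)) => [|v].
    have /rV0Pn[i nzi] := nzw.
    by exists (enum_val i); rewrite enum_valK.
  move/rowP/(_ (enum_rank v)): wE; rewrite !mxE => <-.
  rewrite (reindex _ (onW_bij _ (@enum_rank_bij V))) /=.
  by apply: eq_bigr => u _; rewrite mxE !enum_rankK.
exists (\row_i f (enum_val i)).
  apply/rowP=> i; rewrite !mxE -fE.
  rewrite [RHS](reindex _ (onW_bij _ (@enum_val_bij V))) /=.
  by apply: eq_bigr => j _; rewrite !mxE.
by apply/rV0Pn; exists (enum_rank v0); rewrite mxE enum_rankK.
Qed.

(** * Spectrum of a complete graph with the 2-cycles of an involution removed *)

Section Involution.

Variables (V : finType) (sigma : V -> V) (e : rel V).
Hypothesis sigmaK : involutive sigma.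
Hypothesis eE : forall u v, e u v = (v != u) && (v != sigma u).

Let F := [set v | sigma v == v].

(** A vertex misses only itself and [sigma v]; these coincide exactly on [F], where the term must
    not be subtracted twice. *)
Lemma sum_adjacency (f : V -> algC) v :
  \sum_u f u * (e u v)%:R =
    \sum_u f u - f v - (if v \in F then 0 else f (sigma v)).
Proof.
rewrite inE; have [sv | sv] := eqVneq (sigma v) v.
  rewrite [X in _ = X - _ - _](bigD1 v) //= [LHS](bigD1 v) //=.
  rewrite eE eqxx mulr0 add0r subr0 [X in _ = X - _]addrC addrK.
  apply: eq_bigr => u uv; rewrite eE eq_sym uv -{1}sv (inj_eq (inv_inj sigmaK)).
  by rewrite eq_sym uv mulr1.
rewrite [X in _ = X - _ - _](bigD1 v) //=.
rewrite [X in _ = _ + X - _ - _](bigD1 (sigma v)) //=.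
rewrite [LHS](bigD1 v) //= (bigD1 (sigma v)) //=.
rewrite !eE eqxx sigmaK eqxx andbF !mulr0 !add0r.
rewrite [f v + _]addrC addrK addrAC subrr add0r.
apply: eq_bigr => u /andP[uv usv]; rewrite eE eq_sym uv.
by rewrite -(inj_eq (inv_inj sigmaK)) sigmaK eq_sym usv mulr1.
Qed.

Lemma eigenvalue_rational_or_quadratic (x : algC) :
    eigenvalue (adjacency_mx e) x ->
  x \in Crat \/
  x ^+ 2 = (#|V|%:R - 3) * x + (#|V|%:R + #|F|%:R - 2).
Proof.
case/eigenvalue_adjacencyP=> f [v0 nzf] fE.
(* The rational values 0, -1, -2 are set aside so that [x], [x + 1] and [x + 2] can be cancelled
   below. *)
have [->|x0] := eqVneq x 0; first by left; rewrite rpred0.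
have [->|x1] := eqVneq x (-1); first by left; rewrite rpredN rpred1.
have [->|x2] := eqVneq x (-2); first by left; rewrite rpredN rpred_nat.
have nz1 : x + 1 != 0 by rewrite addr_eq0.
have nz2 : x + 2 != 0 by rewrite addr_eq0.
right; pose S := \sum_u f u.
have fF v : v \in F -> f v = S / (x + 1).
  move=> Fv; have := fE v; rewrite sum_adjacency Fv subr0 -/S => SE.
  by apply: (canRL (mulfK nz1)); rewrite mulrDr mulr1 mulrC -SE subrK.
have fN v : v \notin F -> f v = S / (x + 2).
  move=> Fv; have Fsv : sigma v \notin F.
    by move: Fv; rewrite !inE sigmaK eq_sym.
  have := fE v; have := fE (sigma v).
  rewrite !sum_adjacency (negPf Fv) (negPf Fsv) sigmaK -/S => SE2 SE1.
  (* The equations at [v] and [sigma v] have the same left-hand side, so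
     [x * f v = x * f (sigma v)]. *)
  have fsv : f (sigma v) = f v.
    by apply: (mulfI x0); rewrite -SE1 -SE2; ring.
  apply: (canRL (mulfK nz2)).
  transitivity (x * f v + f v + f v); first by ring.
  by rewrite -SE1 fsv; ring.
have SE : S = S / (x + 1) *+ #|F| + S / (x + 2) *+ #|~: F|.
  rewrite {1}/S (bigID (mem F)) /= (eq_bigr _ fF) (eq_bigr _ fN).
  rewrite !sumr_const; congr (_ + _ *+ _).
  by apply: eq_card => u; rewrite in_setC.
have nzS : S != 0.
  apply: contraNneq nzf => S0.
  by have [/fF|/fN] := boolP (v0 \in F); rewrite S0 mul0r => ->.
have VE : #|V|%:R = #|F|%:R + #|~: F|%:R :> algC by rewrite -natrD cardsC.
(* This is [SE] divided by [S] and cleared of denominators; expanding it gives the quadratic. *)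
have : (x + 1) * (x + 2) = #|F|%:R * (x + 2) + #|~: F|%:R * (x + 1).
  apply: (mulfI nzS); rewrite {1}SE -(mulr_natr _ #|F|) -(mulr_natr _ #|~: F|).
  by field; rewrite nz1 nz2.
rewrite VE => xE; apply/eqP; rewrite -subr_eq0; apply/eqP.
move/eqP: xE; rewrite -subr_eq0 => /eqP <-; ring.
Qed.

Lemma eigenvalue_quadratic (x : algC) :
    (0 < #|F|)%N -> x \notin Crat ->
    x ^+ 2 = (#|V|%:R - 3) * x + (#|V|%:R + #|F|%:R - 2) ->
  eigenvalue (adjacency_mx e) x.
Proof.
case/card_gt0P=> v0 Fv0 Qx xE; apply/eigenvalue_adjacencyP.
have VE : #|V|%:R = #|F|%:R + #|~: F|%:R :> algC by rewrite -natrD cardsC.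
(* These are the values S / (x + 1) and S / (x + 2) forced above, scaled so that S = (x + 1)(x +
   2). *)
exists (fun v => if v \in F then x + 2 else x + 1) => [|v].
  exists v0; rewrite Fv0; apply: contraNneq Qx => /eqP.
  by rewrite addr_eq0 => /eqP ->; rewrite rpredN rpred_nat.
have SE : \sum_u (if u \in F then x + 2 else x + 1) = (x + 1) * (x + 2).
  rewrite big_if /= !sumr_const.
  have -> : #|[pred u | u \notin F]| = #|~: F|.
    by apply: eq_card => u; rewrite inE in_setC.
  rewrite -(mulr_natr _ #|F|) -mulr_natr; apply/eqP; rewrite -subr_eq0; apply/eqP.
  move/eqP: xE; rewrite VE -subr_eq0 => /eqP xE.
  by rewrite -oppr0 -xE; ring.
rewrite sum_adjacency SE.
have [Fv|Fv] := ifPn; first by ring.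
have -> : sigma v \in F = false.
  by apply: negbTE; move: Fv; rewrite !inE sigmaK eq_sym.
ring.
Qed.

Lemma Q_adjoin_degree_spectrum (n1 : nat) :
    (0 < n1)%N -> (n1 < #|V|./2)%N -> ~~ odd #|V| -> #|F| = (2 * n1)%N ->
  Q_adjoin_degree (eigenvalue (adjacency_mx e)) 2.
Proof.
move=> n1_gt0 n1_lt V_even cardF; set A := adjacency_mx e.
pose b : algC := #|V|%:R - 3.
pose c : algC := #|V|%:R + #|F|%:R - 2.
(* The discriminant of X^2 - b X - c. *)
pose d : nat := ((#|V| - 1) ^ 2 + 8 * n1)%N.
have dE : b ^+ 2 + 4 * c = d%:R.
  by rewrite /d natrD natrX natrB ?natrM /b /c ?cardF ?natrM; [ring | lia].
have V_gt1 : (1 < #|V|)%N by lia.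
(* d lies strictly between the squares of |V| - 1 and |V| + 1, and has the
   parity of |V| - 1. *)
have d_nonsquare k : d <> (k ^ 2)%N.
  move=> dk; have k_lo : (#|V| - 1 < k)%N by rewrite -ltn_sqr -dk /d; lia.
  have k_hi : (k < #|V| + 1)%N by rewrite -ltn_sqr -dk /d; nia.
  have kV : k = #|V| by lia.
  move/(congr1 odd): dk; rewrite kV /d oddD oddM andFb addbF !oddX /=.
  by rewrite oddB ?(negPf V_even) // ltnW.
have irrational x : x ^+ 2 = b * x + c -> x \notin Crat.
  move=> xE; apply/negP=> Qx.
  (* Completing the square: [2 * x - b] is a square root of [d], and it is rational if [x] is. *)
  have [||m] := @Crat_sqr_nat (2 * x - b) d; last exact: d_nonsquare.
    by rewrite !rpredB ?rpredM ?rpred_nat.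
  by rewrite -dE; apply/eqP; rewrite -subr_eq0; apply/eqP;
    transitivity (4 * (x ^+ 2 - (b * x + c))); [ring | rewrite xE; ring].
(* The spectrum as a finite list: the roots of the characteristic polynomial. *)
have [r rE] := closed_field_poly_normal (char_poly A).
have mem_r x : (x \in r) = eigenvalue A x.
  rewrite eigenvalue_root_char rE (monicP (char_poly_monic A)) scale1r.
  by rewrite root_prod_XsubC.
pose x0 := (b + sqrtC (b ^+ 2 + 4 * c)) / 2.
have x0E : x0 ^+ 2 = b * x0 + c.
  by rewrite /x0 expr_div_n sqrrD sqrtCK; field.
have bE : b = ratr (#|V|%:R - 3) by rewrite rmorphB !rmorph_nat.
have cE : c = ratr (#|V|%:R + #|F|%:R - 2).
  by rewrite rmorphB rmorphD !rmorph_nat.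
have [|||y ry|L [iota [s [sr genL dimL]]]] :=
  @Q_adjoin_degree_quadratic r (#|V|%:R - 3) (#|V|%:R + #|F|%:R - 2) x0.
- by rewrite mem_r eigenvalue_quadratic ?irrational // cardF; lia.
- exact: irrational.
- by rewrite -bE -cE.
- by rewrite -bE -cE; apply: eigenvalue_rational_or_quadratic; rewrite -/A -mem_r.
exists L, iota, s; split=> // x; rewrite sr; exact: mem_r.
Qed.

End Involution.
End EigenvalueField.

(** * Unique non-neighbours, and the effect of the added edges *)

Lemma degree_graph_sym (gT : finGroupType) (G : {group gT}) :
  symmetric (@degree_graph gT G).
Proof. by move=> p q; rewrite /degree_graph eq_sym mulnC. Qed.

Lemma degree_graph_irr (gT : finGroupType) (G : {group gT}) :
  irreflexive (@degree_graph gT G).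
Proof. by move=> p; rewrite /degree_graph eqxx. Qed.

Lemma regular_partner (V : finType) (e : rel V) :
    1 < #|V| -> symmetric e -> irreflexive e -> regular e (#|V| - 2) ->
  exists2 p : V -> V, involutive p &
    forall u, p u != u /\ forall v, e u v = (v != u) && (v != p u).
Proof.
move=> V_gt1 e_sym e_irr e_reg.
(* Besides [u] itself, exactly |V| - (|V| - 2) - 1 = 1 vertex is not adjacent to [u]. The sigma type
   lets the partner be used as a function. *)
have partner u : {w | w != u & forall v, e u v = (v != u) && (v != w)}.
  pose N := [set w | e u w].
  have : #|~: N :\ u| == 1.
    have := cardsC N; rewrite (cardsD1 u (~: N)) !inE e_irr [X in X + _]e_reg.
    lia.
  case/cards1P/sig_eqW=> w /setP Nw; exists w.
    by have := Nw w; rewrite !inE eqxx => /andP[].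
  move=> v; have := Nw v; rewrite !inE.
  have [->|_] /= := eqVneq v u; first by rewrite e_irr.
  by move=> <-; rewrite negbK.
pose p u := s2val (partner u).
have pP u : p u != u by exact: s2valP (partner u).
have eP u v : e u v = (v != u) && (v != p u) by exact: s2valP' (partner u) v.
exists p => // u; apply/eqP.
(* By symmetry [u] is a non-neighbour of [p u], hence its partner. *)
have : e (p u) u = false by rewrite e_sym eP eqxx andbF.
by rewrite eP eq_sym pP /= => /negbFE; rewrite eq_sym.
Qed.

Lemma add_edges_partner (V : finType) (e : rel V) (M : {set {set V}}) :
    1 < #|V| -> symmetric e -> irreflexive e -> regular e (#|V| - 2) ->
    (forall s, s \in M -> non_edge e s) -> trivIset M ->
  exists2 sigma : V -> V, involutive sigma &
    (forall u v, add_edges e M u v = (v != u) && (v != sigma u)) /\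
    #|[set v | sigma v == v]| = 2 * #|M|.
Proof.
move=> V_gt1 e_sym e_irr e_reg hM tiM.
have [p pK pP] := regular_partner _ _ V_gt1 e_sym e_irr e_reg.
have pn u : p u != u := (pP u).1.
have eP u v : e u v = (v != u) && (v != p u) := (pP u).2 v.
have Mpair s : s \in M -> exists u, s = [set u; p u].
  case/hM/existsP=> u /existsP[v /and3P[uv neuv /eqP ->]]; exists u.
  by move: neuv; rewrite eP eq_sym uv /= negbK => /eqP ->.
have pairM u v : [set u; v] \in M -> v = p u.
  case/Mpair=> w /setP E.
  have := E u; have := E w; have := E (p w).
  rewrite !inE !eqxx !orbT /= => Epw Ew /esym Eu.
  case/orP: Eu Epw Ew => /eqP -> Epw Ew.
    by move: Epw; rewrite (negPf (pn w)) => /eqP.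
  by move: Ew; rewrite eq_sym (negPf (pn w)) pK => /eqP.
(* Adding the edge {u, p u} removes the only non-neighbour of both ends, so both become fixed
   points. *)
pose sigma u := if [set u; p u] \in M then u else p u.
exists sigma => [u|]; [|split=> [u v|]].
- rewrite /sigma; have [Mu|/negPf Mu] := boolP ([set u; p u] \in M).
    by rewrite Mu.
  by rewrite pK setUC Mu.
- rewrite /add_edges eP /sigma.
  have [->|vu] /= := eqVneq v u.
    (* No loop is created: a singleton {u} in [M] would force [p u = u]. *)
    by apply/negP => /pairM /esym/eqP; rewrite (negPf (pn u)).
  have [->|vpu] /= := eqVneq v (p u); last first.
    by case: ifP => _; rewrite ?vu.
  by case: ifPn => _; rewrite ?pn ?eqxx.
have -> : [set v | sigma v == v] = cover M.
  apply/setP=> v; rewrite inE /sigma; apply/idP/bigcupP.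
    case: ifPn => [Mv _|_]; last by rewrite (negPf (pn v)).
    by exists [set v; p v]; rewrite // !inE eqxx.
  case=> s Ms; have [w sE] := Mpair s Ms; rewrite sE in Ms *.
  rewrite !inE => /orP[] /eqP ->; first by rewrite Ms eqxx.
  by rewrite pK setUC Ms eqxx.
(* Disjointness of the chosen non-edges enters here. *)
have -> : #|cover M| = \sum_(s in M) #|s|.
  by apply/eqP; case: (leq_card_cover M) => _ ->.
rewrite (eq_bigr (fun=> 2)) => [|s /Mpair[u ->]].
  by rewrite sum_nat_const mulnC.
by rewrite cards2 eq_sym pn.
Qed.

Theorem corollary4p3 (n : nat) (hn : 4 <= n) (hn_even : ~~ odd n)
    (gT : finGroupType) (G : {group gT}) (solG : solvable G)
    (hcard : #|degree_vertex G| = n)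
    (hreg : regular (@degree_graph gT G) (n - 2))
    (n1 : nat) (hn1_pos : 1 <= n1) (hn1_lt : n1 < n./2)
    (M : {set {set degree_vertex G}})
    (hMcard : #|M| = n1)
    (hM : forall s, s \in M -> non_edge (@degree_graph gT G) s)
    (hMdisj : trivIset M) :
  Q_adjoin_degree
    (eigenvalue (adjacency_mx (add_edges (@degree_graph gT G) M))) 2.
Proof.
have V_gt1 : 1 < #|degree_vertex G| by rewrite hcard; lia.
rewrite -hcard in hreg.
have [sigma sigmaK [eE]] := add_edges_partner _ _ M V_gt1
  (@degree_graph_sym _ G) (@degree_graph_irr _ G) hreg hM hMdisj.
rewrite hMcard => cardF.
by apply: (Q_adjoin_degree_spectrum _ sigma _ sigmaK eE n1); rewrite ?hcard.
Qed.
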